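(* Let $\beta>0$, $\kappa>0$, $c>0$ be real numbers. Then $$u(x,t)=\frac{5c}{2\kappa}\,\mathrm{cn}^4\left[\frac{\sqrt2}{2}\sqrt[4]{\frac{c}{42\beta}}\,(x-ct);\frac{\sqrt2}{2}\right]$$ is a solution on $\mathbb R^2$ of the transmission line equation $$u_t+\kappa u u_x-\beta u_{xxxxx}=0$$ with nonzero boundary condition, i.e. as a function of $\xi=x-ct$ it satisfies $$-cu+\tfrac{\kappa}{2}u^2-\beta u_{\xi\xi\xi\xi}=\mathcal A$$ for some constant $\mathcal A\neq 0$.
   Context: $\mathrm{cn}(\theta;m)$ denotes the Jacobi elliptic cosine with modulus $m$ (not parameter $m^2$), i.e. the solution $w$ of $w''=(2m^2-1)w-2m^2w^3$, $w(0)=1$, $w'(0)=0$, which satisfies $(w')^2=(1-w^2)(1-m^2+m^2w^2)$. *)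

(* Defs.v *)
From Stdlib Require Import Reals ClassicalEpsilon.
From Coquelicot Require Import Coquelicot.
Open Scope R_scope.

(* [m] is the modulus, not the parameter m^2. *)
Definition is_jacobi_cn (m : R) (w : R -> R) : Prop :=
  w 0 = 1 /\
  Derive w 0 = 0 /\
  forall x : R,
    ex_derive w x /\
    is_derive (Derive w) x ((2 * m ^ 2 - 1) * w x - 2 * m ^ 2 * w x ^ 3).

(* The initial value problem above has exactly one solution on the whole line
   for every real [m]; existence is not built in, so any property of [cn]
   rests on a proof that [is_jacobi_cn m] is inhabited. *)
Definition cn (m : R) : R -> R :=
  epsilon (inhabits (fun _ : R => 0)) (is_jacobi_cn m).

Definition transmission_profile (beta kappa c xi : R) : R :=
  5 * c / (2 * kappa) *
  cn (sqrt 2 / 2) (sqrt 2 / 2 * Rpower (c / (42 * beta)) (1 / 4) * xi) ^ 4.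

(* [ex_derive_n f n x] only asserts differentiability of the total function
   [Derive_n f (n - 1)] at [x], so all lower orders are required as well. *)
Definition n_times_derivable (n : nat) (f : R -> R) : Prop :=
  forall (k : nat) (x : R), (k <= n)%nat -> ex_derive_n f k x.

(* Classical solutions on the plane of u_t + kappa u u_x - beta u_xxxxx = 0:
   u is C^1 in t and C^5 in x, with derivatives jointly continuous. *)
Definition transmission_line_solution
    (beta kappa : R) (u : R -> R -> R) : Prop :=
  (forall x t : R, ex_derive (fun s => u x s) t) /\
  (forall t : R, n_times_derivable 5 (fun y => u y t)) /\
  (forall x t : R,
     continuity_2d_pt (fun y s => Derive (fun r => u y r) s) x t) /\
  (forall (k : nat) (x t : R), (k <= 5)%nat ->
     continuity_2d_pt (fun y s => Derive_n (fun z => u z s) k y) x t) /\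
  (forall x t : R,
     Derive (fun s => u x s) t + kappa * u x t * Derive (fun y => u y t) x
     - beta * Derive_n (fun y => u y t) 5 x = 0).

(* Main.v *)
(** Existence of cn: write [w = cos am], where the amplitude [am] inverts the
    integral of [1 / sqrt (1 - m^2 sin^2)]. That integral has derivative at
    least 1 when [m^2 < 1], so its inverse is global and the degenerate points
    [w = 1, -1] of the first-order equation for [w] cause no trouble.
    For [m^2 = 1/2] the equation is [w'' = - w^3] with [w'^2 = (1 - w^4) / 2],
    whence [(w^4)'''' = 6 - 168 w^4 + 210 w^8]. With wavenumber [a] such that
    [168 beta a^4 = c], the [w^4] and [w^8] terms cancel and the constant is
    [- 6 beta a^4 * 5 c / (2 kappa)]; the partial differential equation is the
    derivative of this identity. *)

Require Import Defs.
From Stdlib Require Import Reals Lra Lia ClassicalEpsilon.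
From Coquelicot Require Import Coquelicot.
Open Scope R_scope.

(** * Existence of the elliptic cosine *)

Lemma expanding_increment (F dF : R -> R)
    (F_deriv : forall x, is_derive F x (dF x)) (dF_ge1 : forall x, 1 <= dF x) (x y : R) :
  x <= y -> y - x <= F y - F x.
Proof.
intros Hxy.
destruct (MVT_gen F x y dF) as [z [_ Hz]].
- intros z _; apply F_deriv.
- intros z _; apply continuity_pt_filterlim, (ex_derive_continuous F z).
  now exists (dF z).
- rewrite Hz; specialize (dF_ge1 z); nra.
Qed.

(** This bound makes [F] injective and every right inverse of it 1-Lipschitz, which is what the
    differentiation of the inverse rests on. *)
Lemma expanding_dist (F dF : R -> R)
    (F_deriv : forall x, is_derive F x (dF x)) (dF_ge1 : forall x, 1 <= dF x) (x y : R) :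
  Rabs (y - x) <= Rabs (F y - F x).
Proof.
destruct (Rle_dec x y) as [H|H].
- assert (H1 := expanding_increment F dF F_deriv dF_ge1 x y H).
  rewrite !Rabs_pos_eq; lra.
- assert (H1 := expanding_increment F dF F_deriv dF_ge1 y x ltac:(lra)).
  rewrite !Rabs_left1; lra.
Qed.

Lemma expanding_surjective (F dF : R -> R)
    (F_deriv : forall x, is_derive F x (dF x)) (dF_ge1 : forall x, 1 <= dF x) (y : R) :
  exists x, F x = y.
Proof.
(* Growth at rate at least 1 gives [F (- b) <= y <= F b], so the intermediate value theorem applies
   on this interval. *)
set (b := Rabs (y - F 0)).
assert (Hb : 0 <= b) by apply Rabs_pos.
assert (H1 := expanding_increment F dF F_deriv dF_ge1 0 b Hb).
assert (H2 := expanding_increment F dF F_deriv dF_ge1 (- b) 0 ltac:(lra)).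
assert (H3 : - b <= y - F 0 <= b) by (apply Rabs_le_between; apply Rle_refl).
destruct (IVT_gen F (- b) b y) as [x [_ Hx]].
- intros z; apply continuity_pt_filterlim, (ex_derive_continuous F z).
  now exists (dF z).
- rewrite Rmin_left, Rmax_right; lra.
- now exists x.
Qed.

Lemma expanding_inverse (F dF : R -> R)
    (F_deriv : forall x, is_derive F x (dF x)) (dF_ge1 : forall x, 1 <= dF x) :
  exists g : R -> R,
    (forall y, F (g y) = y) /\ forall y, is_derive g y (/ dF (g y)).
Proof.
assert (Hex : exists g : R -> R, forall y, F (g y) = y).
{ exists (fun y => epsilon (inhabits 0) (fun x => F x = y)); intros y.
  apply (epsilon_spec (inhabits 0) (fun x => F x = y)).
  now apply (expanding_surjective F dF). }
destruct Hex as [g Hg].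
exists g; split; [exact Hg|].
intros y.
apply is_derive_Reals; intros eps Heps.
assert (HF := proj1 (is_derive_Reals _ _ _) (F_deriv (g y)) eps Heps).
destruct HF as [delta Hdelta].
exists delta; intros h Hh Hhd.
(* The increment [k] of [g] satisfies [Rabs k <= Rabs h], so the [delta] obtained for [F] at [g y]
   serves unchanged for [g] at [y]. *)
assert (Hdist := expanding_dist F dF F_deriv dF_ge1 (g y) (g (y + h))).
rewrite !Hg in Hdist.
replace (y + h - y) with h in Hdist by ring.
set (k := g (y + h) - g y) in *.
assert (Hk : k <> 0).
{ intros Hk; apply Hh.
  assert (Heq : g (y + h) = g y) by (unfold k in Hk; lra).
  apply (f_equal F) in Heq; rewrite !Hg in Heq; lra. }
specialize (Hdelta k Hk ltac:(lra)).
replace (g y + k) with (g (y + h)) in Hdelta by (unfold k; ring).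
rewrite !Hg in Hdelta.
replace (y + h - y) with h in Hdelta by ring.
assert (Hd := dF_ge1 (g y)).
(* k/h - 1/d = - (h/k - d) * (k/h) / d, where |k/h| <= 1 <= d *)
replace (k / h - / dF (g y))
  with (- (h / k - dF (g y)) * (k / h * / dF (g y))) by (field; lra).
rewrite (Rabs_mult (- _)), Rabs_Ropp.
apply Rle_lt_trans with (Rabs (h / k - dF (g y)) * 1); [|lra].
apply Rmult_le_compat_l; [apply Rabs_pos|].
assert (Hh0 := Rabs_pos_lt _ Hh).
rewrite Rabs_mult, Rabs_div, Rabs_inv, (Rabs_pos_eq (dF (g y))) by lra.
rewrite <- (Rmult_1_r 1).
apply Rmult_le_compat.
- apply Rdiv_le_0_compat; [apply Rabs_pos|lra].
- apply Rlt_le, Rinv_0_lt_compat; lra.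
- apply Rle_div_l; lra.
- rewrite <- Rinv_1; apply Rinv_le_contravar; lra.
Qed.

Lemma dn_radicand_bounds (m phi : R) :
  m ^ 2 < 1 -> 0 < 1 - m ^ 2 * sin phi ^ 2 <= 1.
Proof.
intros Hm.
assert (H := sin2_cos2 phi); unfold Rsqr in H.
assert (0 <= m ^ 2) by apply pow2_ge_0.
assert (0 <= sin phi ^ 2) by apply pow2_ge_0.
assert (sin phi ^ 2 <= 1) by (assert (0 <= cos phi ^ 2) by apply pow2_ge_0; nra).
nra.
Qed.

(* The amplitude inverts the incomplete elliptic integral of the first kind. *)
Lemma jacobi_am_exists (m : R) (Hm : m ^ 2 < 1) :
  exists am : R -> R,
    am 0 = 0 /\
    forall x, is_derive am x (sqrt (1 - m ^ 2 * sin (am x) ^ 2)).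
Proof.
set (dn := fun phi => sqrt (1 - m ^ 2 * sin phi ^ 2)).
assert (Hdn0 : forall phi, 0 < dn phi).
{ intros phi; apply sqrt_lt_R0, dn_radicand_bounds, Hm. }
assert (Hdn1 : forall phi, dn phi <= 1).
{ intros phi; rewrite <- sqrt_1; apply sqrt_le_1_alt, dn_radicand_bounds, Hm. }
assert (Hcont : forall phi, continuous (fun z => / dn z) phi).
{ intros phi; apply (ex_derive_continuous (fun z => / dn z)).
  unfold dn; auto_derive.
  assert (Hb := dn_radicand_bounds m phi Hm).
  assert (Hp : 0 < 1 + - (m * (m * 1) * (sin phi * (sin phi * 1)))) by lra.
  repeat split; [exact Hp|].
  now apply Rgt_not_eq, sqrt_lt_R0. }
set (F := fun phi => RInt (fun z => / dn z) 0 phi).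
assert (HF : forall phi, is_derive F phi (/ dn phi)).
{ intros phi; apply (is_derive_RInt (fun z => / dn z) F 0); [|apply Hcont].
  apply filter_forall; intros z.
  apply (@RInt_correct R_CompleteNormedModule).
  apply (@ex_RInt_continuous R_CompleteNormedModule).
  intros; apply Hcont. }
(* Since [dn <= 1], the elliptic integral is expanding and has a global differentiable inverse. *)
assert (Hge : forall phi, 1 <= / dn phi).
{ intros phi; rewrite <- Rinv_1; apply Rinv_le_contravar; auto. }
destruct (expanding_inverse F (fun phi => / dn phi) HF Hge) as [am [Ham Hd]].
exists am; split.
- assert (HF0 : F 0 = 0) by apply (RInt_point (V := R_CompleteNormedModule)).
  (* Both [0] and [am 0] are sent to 0 by [F], so their distance is at most 0. *)
  assert (H := expanding_dist F (fun phi => / dn phi) HF Hge 0 (am 0)).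
  rewrite Ham, HF0, !Rminus_0_r, Rabs_R0 in H.
  apply Rabs_eq_0; assert (H0 := Rabs_pos (am 0)); lra.
- intros x; specialize (Hd x); rewrite Rinv_inv in Hd; exact Hd.
Qed.

Lemma jacobi_cn_exists (m : R) (Hm : m ^ 2 < 1) : exists w, is_jacobi_cn m w.
Proof.
destruct (jacobi_am_exists m Hm) as [am [Ham0 Ham]].
exists (fun x => cos (am x)).
set (dn := fun x => sqrt (1 - m ^ 2 * sin (am x) ^ 2)).
assert (Hw : forall x, is_derive (fun x => cos (am x)) x (- (sin (am x) * dn x))).
{ intros x; evar_last.
  - apply (is_derive_comp cos am); [apply is_derive_cos|apply Ham].
  - unfold scal; simpl; unfold mult; simpl; fold (dn x).
    unfold dn; simpl; ring. }
assert (Hw' : forall x, Derive (fun x => cos (am x)) x = - (sin (am x) * dn x)).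
{ intros x; apply is_derive_unique, Hw. }
split; [now rewrite Ham0, cos_0|].
split; [rewrite Hw', Ham0, sin_0; ring|].
intros x; split; [eexists; apply Hw|].
apply is_derive_ext with (fun x => - (sin (am x) * dn x)).
{ intros t; symmetry; apply Hw'. }
assert (Hb := dn_radicand_bounds m (am x) Hm).
assert (Hdn : 0 < dn x) by (apply sqrt_lt_R0; lra).
assert (Hdn2 : dn x * dn x = 1 - m ^ 2 * sin (am x) ^ 2)
  by (apply sqrt_sqrt; lra).
unfold dn; auto_derive.
- assert (Hex : ex_derive am x) by (eexists; apply Ham).
  repeat split; auto; simpl in *; lra.
- change (Derive (fun z => am z) x) with (Derive am x).
  rewrite (is_derive_unique _ _ _ (Ham x)).
  replace (1 + - (m * (m * 1) * (sin (am x) * (sin (am x) * 1))))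
    with (1 - m ^ 2 * sin (am x) ^ 2) by ring.
  fold (dn x).
  assert (Hsc := sin2_cos2 (am x)); unfold Rsqr in Hsc.
  assert (Hs : sin (am x) * sin (am x) = 1 - cos (am x) * cos (am x)) by lra.
  (* The first term comes from differentiating [sin (am x)], the second from
     [dn' = - m ^ 2 * sin (am x) * cos (am x)]; both use [am' = dn], and the factor [dn x] cancels
     because it is positive. *)
  transitivity (- (cos (am x) * (dn x * dn x))
    + m ^ 2 * (sin (am x) * sin (am x)) * cos (am x)).
  { field; lra. }
  rewrite Hdn2.
  replace (sin (am x) ^ 2) with (sin (am x) * sin (am x)) by ring.
  rewrite Hs; ring.
Qed.

Lemma cn_spec (m : R) (Hm : m ^ 2 < 1) : is_jacobi_cn m (cn m).
Proof. unfold cn; apply epsilon_spec, jacobi_cn_exists, Hm. Qed.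

(** Conservation of energy: the difference [E] of the two sides has derivative [2 * w'] times the
    residual of the second-order equation, hence 0, and the initial data give [E 0 = 0]. *)
Lemma jacobi_cn_energy (m : R) (w : R -> R) (Hw : is_jacobi_cn m w) (x : R) :
  Derive w x ^ 2 = (1 - w x ^ 2) * (1 - m ^ 2 + m ^ 2 * w x ^ 2).
Proof.
destruct Hw as [Hw0 [Hw0' Hw]].
set (E := fun x => Derive w x ^ 2
  - (1 - w x ^ 2) * (1 - m ^ 2 + m ^ 2 * w x ^ 2)).
assert (HE : forall x, is_derive E x 0).
{ intros z; destruct (Hw z) as [H1 H2].
  unfold E; auto_derive.
  - repeat split; auto; eexists; apply H2.
  - change (fun x => Derive (fun y => w y) x) with (Derive w).
    replace (Derive (fun x0 => Derive w x0) z)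
      with ((2 * m ^ 2 - 1) * w z - 2 * m ^ 2 * w z ^ 3)
      by (symmetry; apply is_derive_unique, H2).
    change (Derive (fun x0 => w x0) z) with (Derive w z).
    ring. }
enough (E x = E 0) as H.
{ unfold E in H; rewrite Hw0, Hw0' in H; lra. }
destruct (MVT_gen E 0 x (fun _ => 0)) as [z [_ Hz]].
- intros; apply HE.
- intros z _; apply continuity_pt_filterlim, (ex_derive_continuous E z).
  now exists 0.
- lra.
Qed.

(** * Travelling waves *)

(** Lets closed forms for the successive derivatives be guessed in advance and checked one order at
    a time. *)
Lemma derive_n_of_chain (F : nat -> R -> R) (n : nat)
    (HF : forall k x, (k < n)%nat -> is_derive (F k) x (F (S k) x)) :
  forall k x, (k <= n)%nat -> Derive_n (F 0%nat) k x = F k x.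
Proof.
induction k as [|k IH]; intros x Hk; [reflexivity|].
simpl; rewrite (Derive_ext _ (F k)) by (intros; apply IH; lia).
apply is_derive_unique, HF; lia.
Qed.

Lemma n_times_derivable_of_chain (F : nat -> R -> R) (n : nat)
    (HF : forall k x, (k < n)%nat -> is_derive (F k) x (F (S k) x)) :
  n_times_derivable n (F 0%nat).
Proof.
intros [|k] x Hk; [exact I|].
apply ex_derive_ext with (F k).
- intros t; symmetry; apply (derive_n_of_chain F n HF); lia.
- eexists; apply HF; lia.
Qed.

Lemma travelling_wave_solution (beta kappa c : R) (f : R -> R)
    (Hf : n_times_derivable 5 f)
    (Hcont : forall k x, (k <= 5)%nat -> continuous (Derive_n f k) x)
    (Hode : forall x,
      - c * Derive f x + kappa * f x * Derive f x - beta * Derive_n f 5 x = 0) :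
  transmission_line_solution beta kappa (fun x t => f (x - c * t)).
Proof.
assert (Hfd : forall x, ex_derive f x) by (intros x; apply (Hf 1%nat x); lia).
assert (Hx : forall k x t,
  Derive_n (fun y => f (y - c * t)) k x = Derive_n f k (x - c * t)).
{ intros k x t; apply (Derive_n_comp_trans f k x (- (c * t))). }
assert (Ht : forall x t,
  is_derive (fun s => f (x - c * s)) t (- c * Derive f (x - c * t))).
{ intros x t; auto_derive; [apply Hfd|].
  change (Derive (fun z => f z)) with (Derive f); ring_simplify.
  reflexivity. }
assert (Hphase : forall x t, continuity_2d_pt (fun y s => y - c * s) x t).
{ intros x t; apply continuity_2d_pt_minus; [apply continuity_2d_pt_id1|].
  apply continuity_2d_pt_mult;
    [apply continuity_2d_pt_const|apply continuity_2d_pt_id2]. }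
assert (Hcomp : forall k x t, (k <= 5)%nat ->
  continuity_2d_pt (fun y s => Derive_n f k (y - c * s)) x t).
{ intros k x t Hk.
  apply (continuity_1d_2d_pt_comp (Derive_n f k) (fun y s => y - c * s));
    [|apply Hphase].
  apply continuity_pt_filterlim, Hcont, Hk. }
split; [|split; [|split; [|split]]].
- intros x t; eexists; apply Ht.
- intros t k x Hk.
  apply (ex_derive_n_comp_trans f k x (- (c * t))), Hf, Hk.
- intros x t.
  (* The time derivative is [- c] times the first space derivative, so its joint continuity is the
     case of order 1 of [Hcomp]. *)
  apply continuity_2d_pt_ext
    with (fun y s => - c * Derive_n f 1 (y - c * s)).
  { intros y s; symmetry; apply is_derive_unique, Ht. }
  apply continuity_2d_pt_mult; [apply continuity_2d_pt_const|].
  apply Hcomp; lia.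
- intros k x t Hk.
  apply continuity_2d_pt_ext with (fun y s => Derive_n f k (y - c * s)).
  { intros y s; symmetry; apply Hx. }
  apply Hcomp, Hk.
- intros x t.
  replace (Derive (fun s => f (x - c * s)) t) with (- c * Derive f (x - c * t))
    by (symmetry; apply is_derive_unique, Ht).
  rewrite Hx.
  change (Derive (fun y => f (y - c * t)) x)
    with (Derive_n (fun y => f (y - c * t)) 1 x).
  rewrite Hx; apply Hode.
Qed.

(** * The lemniscatic case [m = sqrt 2 / 2] *)

Lemma lemniscatic_modulus_sq : (sqrt 2 / 2) ^ 2 = 1 / 2.
Proof.
replace ((sqrt 2 / 2) ^ 2) with (sqrt 2 * sqrt 2 / 4) by field.
rewrite sqrt_sqrt; lra.
Qed.

(** At [m ^ 2 = 1 / 2] the linear coefficient [2 * m ^ 2 - 1] vanishes and the energy factors into a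
    difference of squares in [w ^ 2]. *)
Lemma lemniscatic_cn_spec (w : R -> R) (Hw : is_jacobi_cn (sqrt 2 / 2) w) (x : R) :
  is_derive w x (Derive w x) /\
  is_derive (Derive w) x (- w x ^ 3) /\
  Derive w x ^ 2 = (1 - w x ^ 4) / 2.
Proof.
assert (He := jacobi_cn_energy _ _ Hw x).
destruct Hw as [_ [_ Hw]]; destruct (Hw x) as [H1 H2].
rewrite lemniscatic_modulus_sq in *.
split; [now apply Derive_correct|split].
- evar_last; [exact H2|lra].
- rewrite He; field.
Qed.

(* For [k > 5] the value is junk (that of [k = 5]). *)
Definition cn4_derivative (w : R -> R) (k : nat) (x : R) : R :=
  match k with
  | 0%nat => w x ^ 4
  | 1%nat => 4 * w x ^ 3 * Derive w x
  | 2%nat => 6 * w x ^ 2 - 10 * w x ^ 6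
  | 3%nat => (12 * w x - 60 * w x ^ 5) * Derive w x
  | 4%nat => 6 - 168 * w x ^ 4 + 210 * w x ^ 8
  | _ => (- 672 * w x ^ 3 + 1680 * w x ^ 7) * Derive w x
  end.

Lemma cn4_derivative_chain (w : R -> R) (Hw : is_jacobi_cn (sqrt 2 / 2) w)
    (k : nat) (x : R) (Hk : (k < 5)%nat) :
  is_derive (cn4_derivative w k) x (cn4_derivative w (S k) x).
Proof.
destruct (lemniscatic_cn_spec w Hw x) as [H1 [H2 H3]].
assert (E1 : ex_derive (fun y => w y) x) by (eexists; apply H1).
assert (E2 : ex_derive (fun y => Derive (fun z => w z) y) x)
  by (eexists; apply H2).
assert (D2 : Derive (fun y => Derive w y) x = - w x ^ 3)
  by apply (is_derive_unique _ _ _ H2).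
assert (D1 : forall y, Derive (fun z => w z) y = Derive w y) by reflexivity.
destruct k as [|[|[|[|[|k]]]]]; [| | | | |lia];
  unfold cn4_derivative; auto_derive; repeat split; auto;
  rewrite ?D2, ?D1; try ring.
(* Only the passages from odd to even order, 1 to 2 and 3 to 4, remain: there the square of [w']
   appears and the energy identity turns it into a polynomial in [w]. *)
- transitivity (12 * w x ^ 2 * Derive w x ^ 2 - 4 * w x ^ 6); [ring|].
  rewrite H3; field.
- transitivity ((12 - 300 * w x ^ 4) * Derive w x ^ 2
    - (12 * w x - 60 * w x ^ 5) * w x ^ 3); [ring|].
  rewrite H3; field.
Qed.

(** The chain yields continuity only below order 5; the top order needs that every entry is a
    polynomial in the differentiable functions [w] and [w']. *)
Lemma cn4_derivative_continuous (w : R -> R) (Hw : is_jacobi_cn (sqrt 2 / 2) w)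
    (k : nat) (x : R) : continuous (cn4_derivative w k) x.
Proof.
destruct (lemniscatic_cn_spec w Hw x) as [H1 [H2 H3]].
assert (E1 : ex_derive (fun y => w y) x) by (eexists; apply H1).
assert (E2 : ex_derive (fun y => Derive (fun z => w z) y) x)
  by (eexists; apply H2).
apply (ex_derive_continuous (cn4_derivative w k)).
destruct k as [|[|[|[|[|k]]]]];
  unfold cn4_derivative; auto_derive; repeat split; auto.
Qed.

(** * Scaling of amplitude and wavenumber *)

Definition scaled_chain (K a : R) (F : nat -> R -> R) (k : nat) (x : R) : R :=
  K * a ^ k * F k (a * x).

Lemma scaled_chain_deriv (K a : R) (F : nat -> R -> R) (k : nat) (x : R)
    (HF : is_derive (F k) (a * x) (F (S k) (a * x))) :
  is_derive (scaled_chain K a F k) x (scaled_chain K a F (S k) x).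
Proof.
unfold scaled_chain; auto_derive.
- eexists; apply HF.
- change (Derive (fun y => F k y) (a * x)) with (Derive (F k) (a * x)).
  rewrite (is_derive_unique _ _ _ HF); simpl; ring.
Qed.

Lemma scaled_chain_continuous (K a : R) (F : nat -> R -> R) (k : nat) (x : R)
    (HF : continuous (F k) (a * x)) : continuous (scaled_chain K a F k) x.
Proof.
apply (continuous_scal_r (K * a ^ k) (fun x => F k (a * x))).
apply (continuous_comp (fun x => a * x) (F k)); [|exact HF].
apply (continuous_scal_r a (fun x : R => x)), continuous_id.
Qed.

Lemma wavenumber_pow4 (beta c : R) (hbeta : 0 < beta) (hc : 0 < c) :
  (sqrt 2 / 2 * Rpower (c / (42 * beta)) (1 / 4)) ^ 4 = c / (168 * beta).
Proof.
assert (Hq : 0 < c / (42 * beta)) by (apply Rdiv_lt_0_compat; lra).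
rewrite Rpow_mult_distr.
replace ((sqrt 2 / 2) ^ 4) with (((sqrt 2 / 2) ^ 2) ^ 2) by ring.
rewrite lemniscatic_modulus_sq.
(* As a real power, the exponent 4 cancels [1 / 4]; the factor [(1 / 2) ^ 2] then turns 42 into
   168. *)
rewrite <- (Rpower_pow 4) by apply exp_pos.
rewrite Rpower_mult.
replace (1 / 4 * INR 4) with 1 by (simpl; field).
rewrite Rpower_1 by exact Hq.
field; lra.
Qed.

Theorem mainTheorem3 (beta kappa c : R)
    (hbeta : 0 < beta) (hkappa : 0 < kappa) (hc : 0 < c) :
  transmission_line_solution beta kappa
    (fun x t => transmission_profile beta kappa c (x - c * t)) /\
  n_times_derivable 4 (transmission_profile beta kappa c) /\
  exists A : R, A <> 0 /\
    forall xi : R,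
      - c * transmission_profile beta kappa c xi
      + kappa / 2 * transmission_profile beta kappa c xi ^ 2
      - beta * Derive_n (transmission_profile beta kappa c) 4 xi = A.
Proof.
assert (Hw : is_jacobi_cn (sqrt 2 / 2) (cn (sqrt 2 / 2))).
{ apply cn_spec; rewrite lemniscatic_modulus_sq; lra. }
assert (Ha := wavenumber_pow4 beta c hbeta hc).
set (w := cn (sqrt 2 / 2)) in *.
set (a := sqrt 2 / 2 * Rpower (c / (42 * beta)) (1 / 4)) in *.
set (K := 5 * c / (2 * kappa)).
set (G := scaled_chain K a (cn4_derivative w)).
assert (Hu : forall x, transmission_profile beta kappa c x = G 0%nat x).
{ intros x; unfold transmission_profile, G, scaled_chain; fold w a K.
  simpl; ring. }
assert (HG : forall k x, (k < 5)%nat -> is_derive (G k) x (G (S k) x)).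
{ intros k x Hk; now apply scaled_chain_deriv, cn4_derivative_chain. }
assert (Hn : forall k x, (k <= 5)%nat ->
  Derive_n (transmission_profile beta kappa c) k x = G k x).
{ intros k x Hk; rewrite (Derive_n_ext _ _ k x Hu).
  now apply (derive_n_of_chain G 5 HG). }
assert (Hd : n_times_derivable 5 (transmission_profile beta kappa c)).
{ intros k x Hk; apply ex_derive_n_ext with (G 0%nat).
  - intros t; symmetry; apply Hu.
  - now apply (n_times_derivable_of_chain G 5 HG). }
split; [|split].
- apply travelling_wave_solution; [exact Hd| |].
  + intros k x Hk; apply continuous_ext with (G k).
    * intros t; symmetry; now apply Hn.
    * apply scaled_chain_continuous, cn4_derivative_continuous, Hw.
  + intros x.
    change (Derive (transmission_profile beta kappa c) x)
      with (Derive_n (transmission_profile beta kappa c) 1 x).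
    rewrite Hu, !Hn by lia.
    unfold G, scaled_chain, cn4_derivative.
    (* Isolating [a ^ 4] lets [Ha] eliminate it. The coefficients of [w ^ 3 * w'] then cancel
       because [672 * beta * a ^ 4 = 4 * c], those of [w ^ 7 * w'] because
       [4 * kappa * K = 10 * c]. *)
    replace (a ^ 5) with (a * a ^ 4) by ring.
    rewrite Ha; unfold K; field; lra.
- intros k x Hk; apply Hd; lia.
(* This is the surviving constant [- 6 * beta * a ^ 4 * K], with [beta * a ^ 4 = c / 168]. *)
- exists (- (K * c / 28)); split.
  + assert (HK : 0 < K) by (apply Rdiv_lt_0_compat; lra).
    assert (0 < K * c) by nra; lra.
  + intros xi; rewrite Hu, Hn by lia.
    unfold G, scaled_chain, cn4_derivative.
    rewrite Ha; unfold K; field; lra.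
Qed.
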